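(* Let $G$ be a countably infinite discrete amenable group and let $G\curvearrowright X$ be a free action by homeomorphisms on a compact metrizable space. If the action has URPC (the Uniform Rokhlin Property and comparison), then it has property FCSB. If the action has URP, then it has property FCSB in measure.
   Context: A set $U\subset X$ is $L$-free (for finite $L\subset G$) if the translates $gU$, $g\in L$, are pairwise disjoint. A marker set is an open set $U\subset X$ with $\bigcup_{g\in G}gU=X$. The marker property: for every finite $L\subset G$ there is an $L$-free marker set. $M_G(X)$ is the set of $G$-invariant Borel probability measures on $X$. Subequivalence: for closed sets $A_1,\dots,A_p\subset X$ and an open set $B\subset X$, $\sum_i[A_i]\prec B$ means that for each $i$ there is a finite open cover $\{U_{i,k}\}_k$ of $A_i$ and elements $g_{i,k}\in G$ such that all the sets $g_{i,k}U_{i,k}$ (over all pairs $(i,k)$) are pairwise disjoint subsets of $B$. A finite set $S\subset G$ is $(K,\varepsilon)$-invariant if $\left|\bigcap_{g\in K}gS\right|>(1-\varepsilon)|S|$. For $A\subset X$ the upper Banach density is $\overline{D}(A)=\inf_F\sup_{x\in X}\frac{|A\cap Fx|}{|F|}$, over nonempty finite $F\subset G$. A tower is a pair $(S,V)$ with $S\subset G$ finite (the shape) and $V\subset X$ open and $S$-free; $SV=\bigcup_{g\in S}gV$. A castle is a finite collection of towers $\{(S_i,V_i)\}_{i=1}^n$ with the sets $S_iV_i$ pairwise disjoint. URP: for every finite $K\subset G$ and $\varepsilon>0$ there is a castle with $(K,\varepsilon)$-invariant shapes and $\overline{D}\left(X\setminus\bigsqcup_iS_iV_i\right)<\varepsilon$.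 Comparison: $[A]\prec B$ whenever $A$ is closed, $B$ is open and $\mu(A)<\mu(B)$ for every $\mu\in M_G(X)$. URPC means URP together with comparison. Property FCSB: the action has the marker property, and for every finite $F\subset G$ and every marker set $V$ there is a finite collection $\{U_i\}_{i=1}^n$ of $F$-free open sets with $\sum_{i=1}^n[\partial U_i]+\left[X\setminus\bigcup_{i=1}^nU_i\right]\prec V$. Property FCSB in measure: for every finite $F\subset G$ and every $\varepsilon>0$ there is a finite collection $\{U_i\}_{i=1}^n$ of $F$-free open sets such that $\sum_{i=1}^n\mu(\partial U_i)+\mu\left(X\setminus\bigcup_{i=1}^nU_i\right)<\varepsilon$ for every $\mu\in M_G(X)$. *)

(* Defs.v *)
From HB Require Import structures.
From mathcomp Require Import all_boot all_order all_algebra finmap.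
From mathcomp Require Import all_classical all_reals all_analysis.

Set Implicit Arguments.
Unset Strict Implicit.
Unset Printing Implicit Defensive.

Import Order.TTheory GRing.Theory Num.Theory.

Local Open Scope classical_set_scope.
Local Open Scope ring_scope.

(* von Neumann: a left-invariant finitely additive probability measure
   defined on all subsets. *)
Definition amenable (R : realType) (G : groupType) : Prop :=
  exists m : set G -> R,
    [/\ forall A, 0 <= m A,
        m [set: G] = 1,
        forall A B, A `&` B = set0 -> m (A `|` B) = m A + m B
      & forall g A, m ((fun s => (g * s)%g) @` A) = m A].

(* #|bigcap_(g in K) g S| > (1 - eps) #|S|.  The cardinal on the left is taken
   in \bar R since the intersection is all of G when K is empty. *)
Definition invariant_shape (R : realType) (G : groupType)
    (K : {fset G}) (eps : R) (S : {fset G}) : Prop :=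
  (((1 - eps) * #|` S|%:R)%:E <
   counting (\bigcap_(g in [set` K]) ((fun s => (g * s)%g) @` [set` S])))%E.

Definition metrizable (R : realType) (X : topologicalType) : Prop :=
  exists (M : metricType R) (f : X -> M) (f' : M -> X),
    [/\ cancel f f', cancel f' f, continuous f & continuous f'].

Definition boundary (X : topologicalType) (A : set X) : set X :=
  closure A `\` interior A.

(* X with a chosen point, which measurable types of the library require. *)
Definition pointed_at (X : topologicalType) (x0 : X) : Type := X.
HB.instance Definition _ (X : topologicalType) (x0 : X) :=
  Choice.on (pointed_at x0).
HB.instance Definition _ (X : topologicalType) (x0 : X) :=
  isPointed.Build (pointed_at x0) x0.

(* The sigma-algebra <<s open>> does not depend on x0. *)
Definition borel (X : topologicalType) (x0 : X) :=
  g_sigma_algebraType (@open X : set (set (pointed_at x0))).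

Section actions.
Context (G : groupType) (X : topologicalType) (act : G -> X -> X).

Definition translate (g : G) (A : set X) : set X := act g @` A.

(* Each act g is a homeomorphism, as act g^-1 is also continuous. *)
Definition action_by_homeo : Prop :=
  [/\ forall x, act 1%g x = x,
      forall g h x, act (g * h)%g x = act g (act h x)
    & forall g, continuous (act g)].

Definition free_action : Prop := forall g x, act g x = x -> g = 1%g.

Definition free_set (L : {fset G}) (U : set X) : Prop :=
  trivIset [set` L] (fun g => translate g U).

Definition marker_set (U : set X) : Prop :=
  open U /\ \bigcup_(g in [set: G]) translate g U = [set: X].

Definition marker_property : Prop :=
  forall L : {fset G}, exists U, marker_set U /\ free_set L U.

(* \sum_i [A i] \prec B, for A i closed and B open.  The cover of A i consists
   of the U i k with k < n i. *)
Definition subequivalent (I : finType) (A : I -> set X) (B : set X) : Prop :=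
  exists (n : I -> nat) (U : I -> nat -> set X) (g : I -> nat -> G),
    [/\ forall i k, (k < n i)%N -> open (U i k),
        forall i, A i `<=` \bigcup_(k in [set k | (k < n i)%N]) U i k,
        forall i k, (k < n i)%N -> translate (g i k) (U i k) `<=` B
      & trivIset [set ik : I * nat | (ik.2 < n ik.1)%N]
          (fun ik => translate (g ik.1 ik.2) (U ik.1 ik.2))].

Definition tower_set (S : {fset G}) (V : set X) : set X :=
  \bigcup_(g in [set` S]) translate g V.

Definition castle (n : nat) (S : 'I_n -> {fset G}) (V : 'I_n -> set X) : Prop :=
  [/\ forall i, open (V i),
      forall i, free_set (S i) (V i)
    & trivIset [set: 'I_n] (fun i => tower_set (S i) (V i))].

Definition FCSB : Prop :=
  marker_property /\
  forall (F : {fset G}) (V : set X), marker_set V ->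
    exists (n : nat) (U : 'I_n -> set X),
      (forall i, open (U i) /\ free_set F (U i)) /\
      subequivalent (fun o : option 'I_n =>
          if o is Some i then boundary (U i)
          else ~` \bigcup_(i in [set: 'I_n]) U i) V.

Context (R : realType).

(* M_G(X).  If X is empty then so is this type, as it should be. *)
Record invariant_measure := InvariantMeasure {
  im_point : X ;
  im_prob : probability (borel im_point) R ;
  im_invariant : forall (g : G) (A : set (borel im_point)),
    measurable A -> im_prob (translate g A) = im_prob A }.

Definition im_fun (mu : invariant_measure) : set X -> \bar R := im_prob mu.
Coercion im_fun : invariant_measure >-> Funclass.

Definition upper_density (A : set X) : \bar R :=
  ereal_inf [set ereal_sup
      [set (#|` fset_set (A `&` (act^~ x @` [set` F]))|%:R / #|` F|%:R)%:E
         | x in [set: X]]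
    | F in [set F : {fset G} | F != fset0]].

Definition URP : Prop :=
  forall (K : {fset G}) (eps : R), 0 < eps ->
    exists (n : nat) (S : 'I_n -> {fset G}) (V : 'I_n -> set X),
      [/\ castle S V,
          forall i, invariant_shape K eps (S i)
        & (upper_density
             (~` \bigcup_(i in [set: 'I_n]) tower_set (S i) (V i)) < eps%:E)%E].

Definition comparison : Prop :=
  forall A B : set X, closed A -> open B ->
    (forall mu : invariant_measure, (mu A < mu B)%E) ->
    subequivalent (fun _ : unit => A) B.

Definition URPC : Prop := URP /\ comparison.

Definition FCSB_in_measure : Prop :=
  forall (F : {fset G}) (eps : R), 0 < eps ->
    exists (n : nat) (U : 'I_n -> set X),
      (forall i, open (U i) /\ free_set F (U i)) /\
      forall mu : invariant_measure,
        (\sum_(i < n) mu (boundary (U i)) +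
         mu (~` \bigcup_(i in [set: 'I_n]) U i) < eps%:E)%E.

End actions.

Arguments invariant_measure {G X} act R.
Arguments upper_density {G X} act R A.
Arguments URP {G X} act R.
Arguments comparison {G X} act R.
Arguments URPC {G X} act R.
Arguments FCSB_in_measure {G X} act R.

(* Main.v *)
(* Take a castle (S_i, V_i) whose shapes are almost invariant under F, and colour
   the s in S_i with F s inside S_i so that s <> t with g s = h t for some g, h
   in F get different colours; |F^-1 F| + 1 colours suffice.  The union U_c of
   the levels s V_i with s of colour c is F-free.  Since the levels are disjoint
   open sets, the boundary of U_c misses all of them and so lies in the remainder
   of the castle, whose measure is at most its upper density; what the U_c do
   not cover is this remainder and a small proportion of the levels.

   The marker property follows from URP alone: a union of levels, one per tower,
   is a marker set, as an orbit avoiding it would lie in the remainder, which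
   has upper density < 1.  For FCSB, the marker set V contains disjoint marker
   sets, one for each closed set to be absorbed; their measures are bounded below
   by compactness, and comparison applies to each pair separately. *)
Require Import Defs.
From HB Require Import structures.
From mathcomp Require Import all_boot all_order all_algebra finmap.
From mathcomp Require Import all_classical all_reals all_analysis.
From mathcomp.analysis Require Import measurable_realfun.

Set Implicit Arguments.
Unset Strict Implicit.
Unset Printing Implicit Defensive.

Import Order.TTheory GRing.Theory Num.Theory.

Local Open Scope classical_set_scope.

(** * Open covers, and averaging a counting function *)

Lemma compact_cover_compact (X : topologicalType) :
  compact [set: X] -> cover_compact [set: X].
Proof.
have [[x0]|noX] := pselect (inhabited X).
  pose P : ptopologicalType := HB.pack (pointed_at x0) (Topological.class X).
  by move=> h; have := h : compact [set: P]; rewrite compact_cover.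
by move=> _ I D f _ _; exists fset0 => [i|x _]; [rewrite in_fset0|case: noX].
Qed.

(** Integrate the pointwise bound against [P]: the indicators contribute [m] each, and the constant
    [s] has integral [s]. *)
Lemma sum_indic_le_probability d (T : measurableType d) (R : realType)
    (P : probability T R) (I : choiceType) (F : {fset I}) (A : I -> set T)
    (m s : \bar R) :
  (forall i, measurable (A i)) -> (forall i, P (A i) = m) ->
  (forall x, \sum_(i <- F) (\1_(A i) x)%:E <= s)%E ->
  (#|` F|%:R%:E * m <= s)%E.
Proof.
move=> mA PA le_s.
have mf i : measurable_fun [set: T] (fun x => (\1_(A i) x)%:E : \bar R).
  by apply/measurable_EFinP; exact: measurable_indic.
have <- : (\int[P]_x (\sum_(i <- F) (\1_(A i) x)%:E) = #|` F|%:R%:E * m)%E.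
  rewrite ge0_integral_sum //.
  rewrite (eq_bigr (fun=> m)) => [|i _]; last first.
    rewrite integral_indic // setIT; exact: PA.
  by rewrite big_const_seq count_predT mule_natl -Monoid.iteropE.
have <- : (\int[P]_x cst s x = s)%E.
  rewrite integral_cst // -[RHS]mule1; congr (_ * _)%E.
  exact: probability_setT.
apply: ge0_le_integral => //.
- by move=> x _; apply: sume_ge0 => i _; rewrite lee_fin.
- exact: emeasurable_sum.
Qed.

(** * Invariant measures on open and closed sets *)

Section invariant_measures.
Context (G : groupType) (X : topologicalType) (act : G -> X -> X).
Context (R : realType) (mu : invariant_measure act R).
Local Notation bmeas A := (measurable (A : set (borel (im_point mu)))).

Lemma open_bmeas (A : set X) : open A -> bmeas A.
Proof. by move=> oA; apply: sub_sigma_algebra. Qed.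

Lemma closed_bmeas (A : set X) : closed A -> bmeas A.
Proof.
move=> cA; have /measurableC : bmeas (~` A) by apply: open_bmeas; rewrite openC.
by rewrite setCK.
Qed.

Lemma im_ge0 (A : set X) : (0 <= mu A)%E.
Proof. exact: measure_ge0. Qed.

Lemma im_setT : mu [set: X] = 1%E.
Proof. exact: probability_setT. Qed.

Lemma im_le (A B : set X) : bmeas A -> bmeas B -> A `<=` B -> (mu A <= mu B)%E.
Proof. by move=> mA mB; apply: (le_measure (im_prob mu)); rewrite inE. Qed.

Lemma im_le_sum (I : choiceType) (r : seq I) (A : set X) (B : I -> set X) :
  bmeas A -> (forall i, bmeas (B i)) -> A `<=` \bigcup_(i in [set` r]) B i ->
  (mu A <= \sum_(i <- r) mu (B i))%E.
Proof.
move=> mA mB sAB.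
have mU (s : seq I) : bmeas (\big[setU/set0]_(i <- s) B i).
  by apply: bigsetU_measurable => i _; exact: mB.
rewrite bigcup_seq in sAB; apply: (le_trans (im_le mA (mU r) sAB)) => {mA sAB}.
elim: r => [|i r IH]; first by rewrite !big_nil [mu _](measure0 (im_prob mu)).
rewrite !big_cons; apply: le_trans (leeD2l _ IH).
exact: (@measureU2 _ _ _ (im_prob mu)).
Qed.

Lemma im_sum (I : choiceType) (D : {fset I}) (B : I -> set X) :
  (forall i, bmeas (B i)) -> trivIset [set` D] B ->
  mu (\bigcup_(i in [set` D]) B i) = (\sum_(i <- D) mu (B i))%E.
Proof.
by move=> mB tB; rewrite bigcup_seq; apply: (measure_fbigsetU (im_prob mu)).
Qed.

End invariant_measures.

Section actions.
Context (G : groupType) (X : topologicalType) (act : G -> X -> X).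
Hypothesis act_homeo : action_by_homeo act.
Local Notation tr := (translate act).

Let act1 x : act 1%g x = x. Proof. by case: act_homeo. Qed.
Let actM g h x : act (g * h)%g x = act g (act h x).
Proof. by case: act_homeo. Qed.
Let actK g : cancel (act g) (act g^-1%g).
Proof. by move=> x; rewrite -actM mulVg act1. Qed.
Let actVK g : cancel (act g^-1%g) (act g).
Proof. by move=> x; rewrite -actM mulgV act1. Qed.

Lemma translateE g A : tr g A = act g^-1%g @^-1` A.
Proof.
apply/seteqP; split=> [_ [x Ax <-]|x Ax]; first by rewrite /preimage /= actK.
by exists (act g^-1%g x); rewrite ?actVK.
Qed.

Lemma translate_open g A : open A -> open (tr g A).
Proof.
by move=> oA; rewrite translateE; apply: open_comp => // x _; case: act_homeo.
Qed.

(** * Upper density and orbits of a free action *)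

Section upper_density.
Context (R : realType).
Implicit Types mu : invariant_measure act R.

Lemma im_translate mu g A : open A -> mu (tr g A) = mu A.
Proof. by move=> oA; apply: im_invariant; exact: open_bmeas. Qed.

Lemma im_translate_closed mu g A : closed A -> mu (tr g A) = mu A.
Proof. by move=> oA; apply: im_invariant; exact: closed_bmeas. Qed.

Hypothesis act_free : free_action act.

Lemma free_action_inj x : injective (act^~ x).
Proof.
move=> g h /= gh; apply/(mulgI h^-1%g); rewrite mulVg.
by apply: (act_free (x := x)); rewrite actM gh actK.
Qed.

Lemma card_orbit_fset (A : set X) (F : {fset G}) x :
  #|` fset_set (A `&` (act^~ x @` [set` F]))| =
  (\sum_(g <- F | `[< A (act g x) >]) 1)%N.
Proof.
rewrite big_fset_condE -card_fset_sum1.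
have /card_in_imfsetP/eqP <- :
    {in [fset g in F | `[< A (act g x) >]]%fset &, injective (act^~ x)}.
  by move=> g h _ _ /free_action_inj.
congr (#|` _ |); apply/fsetP => y; rewrite in_fset_set; last first.
  exact: finite_setIr (finite_image _ (finite_fset F)).
apply/idP/imfsetP => [|[g /=]].
  rewrite inE => -[Ay [g Fg gx]]; exists g => //=.
  by rewrite !inE Fg /= gx; apply/asboolP.
rewrite !inE => /andP[Fg /asboolP Ag] ->; split => //.
by exists g.
Qed.

(** For each nonempty [F], average over [x] the number of [g] in [F] with [act g x] in [A]. By
    invariance the mean is [#|F|] times [mu A], and pointwise the number is at most [#|F|] times the
    supremum [s]. *)
Lemma im_le_upper_density mu A : closed A -> (mu A <= upper_density act R A)%E.
Proof.
move=> cA; apply/ereal_infP => _ [F /= F0 <-].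
set s := ereal_sup _.
have N0 : (0 < #|` F|%:R :> R)%R by rewrite ltr0n cardfs_gt0.
rewrite -(@lee_pmul2l _ #|` F|%:R%:E) ?lte_fin //.
apply: (@sum_indic_le_probability _ _ _ (im_prob mu) _ F
  (fun g => tr g^-1%g A)) => [g|g|x].
- apply: closed_bmeas; rewrite translateE; apply: closed_comp => // x _.
  by case: act_homeo.
- exact: (im_translate_closed mu).
- rewrite (_ : (\sum_(g <- F) _)%E =
    (#|` fset_set (A `&` (act^~ x @` [set` F]))|%:R)%:E); last first.
    rewrite card_orbit_fset natr_sum -sumEFin [RHS]big_mkcond /=.
    apply: eq_bigr => g _; rewrite indicE translateE invgK.
    by case: asboolP => h; [rewrite mem_set|rewrite memNset].
  rewrite -lee_pdivrMl //; apply: ereal_sup_ubound; exists x => //.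
  by rewrite -EFinM mulrC.
Qed.

Lemma upper_density_lt1 A x :
  (upper_density act R A < 1)%E -> exists g, ~ A (act g x).
Proof.
move=> /ereal_inf_lt[_ [F /= F0 <-] lt1]; apply: contrapT => /forallNP allA.
move: lt1; apply/negP; rewrite -leNgt; apply: ereal_sup_ubound; exists x => //.
rewrite card_orbit_fset (eq_bigl xpredT) => [|g]; last first.
  by apply/asboolP; apply: contrapT; exact: allA.
by rewrite -card_fset_sum1 divff // pnatr_eq0 cardfs_eq0.
Qed.

End upper_density.

(** * Cores of almost invariant shapes, and colourings *)

Definition core (F S : {fset G}) : {fset G} :=
  [fset s in S | all (fun g => (g * s)%g \in S) F]%fset.

(** The intersection of the translates of [S] by [1] and by the inverses of [F] is exactly
    [core F S]; the element [1] keeps it inside [S]. *)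
Lemma invariant_shape_core (R : realType) (F S : {fset G}) (eps : R) :
  invariant_shape (1%g |` [fset g^-1%g | g in F])%fset eps S ->
  ((1 - eps) * #|` S|%:R < #|` core F S|%:R)%R.
Proof.
rewrite /invariant_shape (_ : \bigcap_(g in _) _ = [set` core F S]).
  by rewrite /counting asboolT ?set_fsetK ?lte_fin //; exact: finite_fset.
apply/seteqP; split => [x xS|x].
  have S_x : x \in S.
    have [|s /= Ss <-] := xS 1%g; first by rewrite /= !inE eqxx.
    by rewrite mul1g.
  rewrite /= !inE S_x; apply/allP => g Fg.
  have [|s /= Ss <-] := xS g^-1%g; last by rewrite mulVKg.
  by rewrite /= !inE in_imfset ?orbT.
rewrite /= !inE => /andP[Sx /allP Fx] g.
rewrite /= !inE => /predU1P[->|/imfsetP[h /= Fh ->]].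
  by exists x => //; rewrite mul1g.
by exists (h * x)%g => /=; rewrite ?mulKg // Fx.
Qed.

(** Elements are coloured one at a time. The neighbours of a new element [a] lie in the translate
    [E a], so they use at most [#|E|] colours and one colour [k] is left over. Symmetry of [E]
    handles both orders of a pair. *)
Lemma greedy_coloring (E : {fset G}) (S : seq G) :
  (forall e, e \in E -> e^-1%g \in E) ->
  exists c : G -> 'I_(#|` E|.+1), forall s t,
    s \in S -> t \in S -> (t / s)%g \in E -> c s = c t -> s = t.
Proof.
move=> E_sym; elim: S => [|a S [c cP]]; first by exists (fun=> ord0).
have [aS|aS] := boolP (a \in S).
  by exists c => s t; rewrite !inE => /predU1P[->|sS] /predU1P[->|tS]; exact: cP.
have [k kE] : exists k, k \notin [seq c (e * a)%g | e <- E].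
  apply/existsP; apply: contraTT (ltnSn #|` E|) => /existsPn allE.
  rewrite -leqNgt -{2}(size_map (fun e => c (e * a)%g)) -[leqLHS]card_ord.
  rewrite cardE; apply: uniq_leq_size => [|k _]; first exact: enum_uniq.
  by have := allE k; rewrite negbK.
have kP s : (s / a)%g \in E -> c s <> k.
  move=> sE ck; move/negP: kE; apply; rewrite -ck.
  by apply/mapP; exists (s / a)%g; rewrite ?mulgVK.
exists (fun x => if x == a then k else c x) => s t.
rewrite !inE; case: eqVneq => [->|sa] /=; case: eqVneq => [->|ta] //=.
- by move=> _ tS tE /esym /(kP _ tE).
- by move=> sS _ /E_sym; rewrite invgF /= => /kP.
- exact: cP.
Qed.

(** * Unions of levels of a castle *)

Section castle.
Context (n : nat) (S : 'I_n -> {fset G}) (V : 'I_n -> set X).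
Hypothesis castleSV : castle act S V.

Lemma castle_inj i j s t v w : s \in S i -> t \in S j -> V i v -> V j w ->
  act s v = act t w -> i = j /\ s = t.
Proof.
case: castleSV => _ freeS disj sS tS Vv Vw st.
have ij : i = j.
  apply: disj => //; exists (act s v); split; first by exists s => //; exists v.
  by exists t => //; exists w.
split=> //; subst j; apply: (freeS i) => //.
by exists (act s v); split; [exists v|exists w].
Qed.

(** [T i] selects levels of the tower [i]: full shapes give the whole castle, colour classes give
    the sets of the FCSB family. *)
Definition levels (T : 'I_n -> set G) : set X :=
  \bigcup_(i in [set: 'I_n]) \bigcup_(s in T i) tr s (V i).

Lemma levels_open T : open (levels T).
Proof.
apply: bigcup_open => i _; apply: bigcup_open => s _; apply: translate_open.
by case: castleSV.
Qed.

(** The core condition keeps [g s] and [h t] in the shapes, so [castle_inj] turns a common point of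
    two translates into an equation [g s = h t] within one tower. *)
Lemma levels_free (F : {fset G}) (T : 'I_n -> set G) :
  (forall i, T i `<=` [set` core F (S i)]) ->
  (forall i s t g h, T i s -> T i t -> g \in F -> h \in F ->
    (g * s = h * t)%g -> g = h) ->
  free_set act F (levels T).
Proof.
move=> Tcore Tinj g h /= Fg Fh [x [[y [i _ [s sT [v Vv]]] <- <-]]].
move=> [z [j _ [t tT [w Vw]]] <-]; rewrite -!actM => hg.
have coreP i' r f : T i' r -> f \in F -> (f * r)%g \in S i'.
  by move=> /Tcore; rewrite /= !inE => /andP[_ /allP]; apply.
have [ij] := castle_inj (coreP _ _ _ tT Fh) (coreP _ _ _ sT Fg) Vw Vv hg.
by subst j => /esym; exact: (Tinj i).
Qed.

Lemma levels_boundary (T : 'I_n -> set G) : (forall i, T i `<=` [set` S i]) ->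
  boundary (levels T) `<=` ~` levels (fun i => [set` S i]).
Proof.
move=> TS x [clx /=]; rewrite (interior_id _).1; last exact: levels_open.
move=> xT [i _ [s /= sS sx]].
have := clx (tr s (V i)); case.
  by apply: open_nbhs_nbhs; split => //; apply: translate_open; case: castleSV.
move=> _ [[j _ [t tT [w Vw <-]]] [v Vv vw]].
have [ij st] := castle_inj sS (TS _ _ tT) Vv Vw vw; subst j t.
by apply: xT; exists i => //; exists s.
Qed.

Context (R : realType).

Lemma im_tower (mu : invariant_measure act R) i (D : {fset G}) :
  {subset D <= S i} -> mu (tower_set act D (V i)) = (#|` D|%:R%:E * mu (V i))%E.
Proof.
case: castleSV => oV freeS _ DS; rewrite im_sum => [|s|]; last 2 first.
- by apply: open_bmeas; apply: translate_open.
- by move=> s t /= /DS sS /DS tS; exact: freeS.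
rewrite (eq_bigr (fun=> mu (V i))) => [|s _]; last exact: im_translate.
by rewrite big_const_seq count_predT mule_natl -Monoid.iteropE.
Qed.

(** All levels of one tower have equal measure, so [D i] takes at most the fraction [d] of the tower
    [i]; the towers are disjoint and have total measure at most 1. *)
Lemma im_sparse_levels (mu : invariant_measure act R) (D : 'I_n -> {fset G}) d :
  (0 <= d)%R -> (forall i, D i `<=` S i)%fset ->
  (forall i, #|` D i|%:R <= d * #|` S i|%:R)%R ->
  (mu (levels (fun i => [set` D i])) <= d%:E)%E.
Proof.
move=> d0 sDS cardD; have [oV freeS disj] := castleSV.
have DS i : {subset D i <= S i} by apply/fsubsetP.
have oT i (E : {fset G}) : open (tower_set act E (V i)).
  by apply: bigcup_open => s _; exact: translate_open.
pose I := fset_set [set: 'I_n].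
have IE : [set` I] = [set: 'I_n] by rewrite fset_setK; last exact: finite_finset.
apply: (@le_trans _ _ (\sum_(i <- I) mu (tower_set act (D i) (V i)))%E).
  apply: im_le_sum; last by rewrite IE.
  - by apply: open_bmeas; exact: levels_open.
  - by move=> i; exact: open_bmeas.
apply: (@le_trans _ _ (\sum_(i <- I) d%:E * mu (tower_set act (S i) (V i)))%E).
  apply: lee_sum => i _; rewrite !im_tower // muleA -EFinM.
  by apply: lee_wpmul2r; rewrite ?im_ge0 ?lee_fin.
rewrite -ge0_sume_distrr => [|i _]; last exact: im_ge0.
rewrite -im_sum; last 2 first.
- by move=> i; apply: open_bmeas.
- by rewrite IE.
rewrite -[leRHS]mule1 lee_wpmul2l ?lee_fin // -(im_setT mu).
apply: im_le => //.
by apply: open_bmeas; apply: bigcup_open.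
Qed.

End castle.

(** * The marker property from URP *)

Section marker_property.
Context (R : realType).
Hypothesis act_free : free_action act.

(** Tolerance 1/2 suffices: the strict lower bound on the size of the core is nonnegative, and 1/2
    is below 1. *)
Lemma castle_core_neq0 (L : {fset G}) : URP act R ->
  exists (n : nat) (S : 'I_n -> {fset G}) (V : 'I_n -> set X),
    [/\ castle act S V, forall i, core L (S i) != fset0
      & (upper_density act R (~` levels V (fun i => [set` S i])) < 1)%E].
Proof.
have half : (0 < 2^-1 :> R)%R by [].
move=> /(_ (1%g |` [fset g^-1%g | g in L])%fset _ half).
move=> [n [S [V [castleSV invS densZ]]]]; exists n, S, V; split => //.
  move=> i; rewrite -cardfs_gt0 -(ltr_nat R).
  apply: le_lt_trans (invariant_shape_core (invS i)).
  by rewrite mulr_ge0 // subr_ge0 invf_le1 // ler1n.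
apply: lt_trans densZ _.
by rewrite lte_fin invf_lt1 // ltr1n.
Qed.

Lemma URP_marker_property : URP act R -> marker_property act.
Proof.
move=> urp L; have [n [S [V [castleSV core0 densZ]]]] := castle_core_neq0 L urp.
have /choice[t tcore] : forall i, exists t, t \in core L (S i).
  by move=> i; exact/fset0Pn.
exists (levels V (fun i => [set t i])); split; last first.
  apply: (levels_free castleSV) => [i _ ->|i _ _ g h -> -> _ _]; first exact: tcore.
  exact: mulIg.
split; first exact: (levels_open castleSV).
apply/seteqP; split => // x _.
have [g /contrapT [i _ [s /= Si [v Vv vx]]]] := upper_density_lt1 act_free x densZ.
(* Since [act g x = act s v], the point [x] is reached from the chosen level [t i] of the same tower
   by going down to [v], up to level [s], and back by [g^-1]. *)
exists (g^-1 * s * (t i)^-1)%g => //.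
exists (act (t i) v); first by exists i => //; exists (t i) => //; exists v.
by rewrite !actM actK vx actK.
Qed.
End marker_property.

(** * FCSB in measure from URP *)

Section FCSB_in_measure.
Context (R : realType).
Hypothesis act_free : free_action act.

Lemma closed_boundary (A : set X) : closed (boundary A).
Proof.
apply: closedI; first exact: closed_closure.
by apply: open_closedC; exact: open_interior.
Qed.

(* [m] comes before [eps]: when comparison is used, [eps] is chosen in terms of
   [m] disjoint targets. *)
Lemma URP_uniform_FCSB_in_measure (F : {fset G}) : URP act R ->
  exists m : nat, forall eps : R, (0 < eps)%R ->
  exists U : 'I_m -> set X, (forall i, open (U i) /\ free_set act F (U i)) /\
    forall mu : invariant_measure act R,
      (\sum_(i < m) mu (boundary (U i)) +
       mu (~` \bigcup_(i in [set: 'I_m]) U i) < eps%:E)%E.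
Proof.
move=> urp.
pose E := [fset (g^-1 * h)%g | g in F, h in F]%fset.
have E_sym e : e \in E -> e^-1%g \in E.
  case/imfset2P => g /= Fg [h /= Fh ->].
  by apply/imfset2P; exists h => //; exists g => //; rewrite invgM invgK.
pose m := #|` E|.+1; exists m => eps eps0.
(* The error is at most [m + 2] times [d]: one for each boundary, one for the remainder of the
   castle, one for the levels outside the cores. The extra unit makes the final inequality
   strict. *)
pose d : R := (eps / (m.+3)%:R)%R.
have d0 : (0 < d)%R by rewrite divr_gt0.
have [n [S [V [castleSV invS densZ]]]] :=
  urp (1%g |` [fset g^-1%g | g in F])%fset d d0.
have /choice[c cP] i := greedy_coloring (core F (S i)) E_sym.
pose T (k : 'I_m) i := [set s | s \in core F (S i) /\ c i s = k].
have TS k i : T k i `<=` [set` S i] by move=> s [+ _]; rewrite /= !inE => /andP[].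
set Z := levels V (fun i => [set` S i]) in densZ.
have oZ : open Z by exact: (levels_open castleSV).
pose D i := (S i `\` core F (S i))%fset.
exists (fun k => levels V (T k)); split => [k|mu].
  split; first exact: (levels_open castleSV).
  apply: (levels_free castleSV) => [i s []//|i s t g h [sS sk] [tS tk] Fg Fh].
  move=> gs_ht; have st : s = t.
    (* From [g s = h t] one gets [t / s = h^-1 g], an element of [E], so equal colours force
       [s = t]. *)
    apply: (cP i) => //; last by rewrite sk tk.
    apply/imfset2P; exists h => //; exists g => //.
    by rewrite -{1}(mulKg h t) -gs_ht mulgA mulgK.
  by apply/(mulIg s); rewrite gs_ht st.
have mZ : (mu (~` Z) <= d%:E)%E.
  by apply/ltW/(le_lt_trans _ densZ)/im_le_upper_density => //; exact: open_closedC.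
have mD : (mu (levels V (fun i => [set` D i])) <= d%:E)%E.
  apply: (im_sparse_levels castleSV) (ltW d0) _ _ => i; first exact: fsubsetDl.
  have := invariant_shape_core (invS i).
  have cS : (core F (S i) `<=` S i)%fset by apply/fsubsetP => s; rewrite !inE => /andP[].
  rewrite cardfsDS // natrB ?fsubset_leq_card // mulrBl mul1r.
  by rewrite ltrBlDr -ltrBlDl => /ltW.
apply: (@le_lt_trans _ _ (\sum_(i < m) d%:E + (d%:E + d%:E))%E).
  apply: leeD.
    apply: lee_sum => k _; apply: le_trans mZ; apply: im_le.
    - by apply: closed_bmeas; exact: closed_boundary.
    - by apply: closed_bmeas; exact: open_closedC.
    - exact: (levels_boundary castleSV).
  apply: le_trans (leeD mZ mD).
  have bZ : measurable (~` Z : set (borel (im_point mu))).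
    by apply: closed_bmeas; exact: open_closedC.
  have bD : measurable (levels V (fun i => [set` D i]) : set (borel (im_point mu))).
    by apply: open_bmeas; exact: (levels_open castleSV).
  apply: le_trans (@measureU2 _ _ _ (im_prob mu) _ _ bZ bD).
  apply: im_le; last 1 first.
  - move=> x xU; have [|nZ] := pselect ((~` Z) x); first by left.
    right; move/contrapT: nZ => [i _ [s Ss sx]]; exists i => //; exists s => //.
    rewrite /= in_fsetD [s \in S i]Ss andbT; apply/negP => sc.
    by apply: xU; exists (c i s) => //; exists i => //; exists s.
  - apply: closed_bmeas; apply: open_closedC; apply: bigcup_open => k _.
    exact: (levels_open castleSV).
  - exact: measurableU.
rewrite sumEFin sumr_const card_ord -!EFinD lte_fin.
rewrite -mulr2n -mulrnDr -mulr_natr /d -mulrA gtr_pMr // mulrC ltr_pdivrMr //.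
by rewrite mul1r ltr_nat addn2.
Qed.

Lemma URP_FCSB_in_measure : URP act R -> FCSB_in_measure act R.
Proof.
move=> urp F eps eps0; have [m mP] := URP_uniform_FCSB_in_measure F urp.
by exists m; exact: mP.
Qed.
End FCSB_in_measure.

(** * FCSB from URP and comparison *)

Section FCSB.
Hypothesis X_compact : compact [set: X].

Lemma marker_finite_cover (V : set X) : marker_set act V ->
  exists D : {fset G}, [set: X] `<=` \bigcup_(g in [set` D]) tr g V.
Proof.
case=> oV VX; have := compact_cover_compact X_compact.
move=> /(_ _ [set: G] (tr^~ V)); case=> [g _||D _ DX].
- exact: translate_open.
- by rewrite -VX.
- by exists D.
Qed.

Lemma marker_measure_gt0 (R : realType) (V : set X) : marker_set act V ->
  exists2 e : R, (0 < e)%R &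
    forall mu : invariant_measure act R, (e%:E <= mu V)%E.
Proof.
move=> mV; have [D DX] := marker_finite_cover mV; have [oV _] := mV.
(* Finitely many translates of [V], all of measure [mu V], cover [X]. The successor keeps the bound
   positive even if [D] is empty. *)
exists (#|` D|.+1%:R^-1)%R => [|mu]; first by rewrite invr_gt0.
have : (1 <= #|` D|%:R%:E * mu V)%E.
  rewrite -(im_setT mu); apply: le_trans (im_le_sum _ _ DX) _.
  - by apply: open_bmeas; exact: openT.
  - by move=> g; apply: open_bmeas; exact: translate_open.
  rewrite (eq_bigr (fun=> mu V)) => [|g _]; last exact: im_translate.
  by rewrite big_const_seq count_predT mule_natl -Monoid.iteropE.
rewrite -[X in (X <= mu V)%E]mule1 lee_pdivrMl // => /le_trans; apply.
by apply: lee_wpmul2r; rewrite ?im_ge0 // lee_fin ler_nat.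
Qed.

(** Each new element is chosen outside the finite union of the translates [E h_i] of the earlier
    ones. *)
Lemma infinite_avoid_translates (E : {fset G}) (n : nat) :
  infinite_set [set: G] ->
  exists h : nat -> G, forall i j, (i < j < n)%N -> (h j / h i)%g \notin E.
Proof.
move=> infG; elim: n => [|n [h hP]].
  by exists (fun=> 1%g) => i j; rewrite ltn0 andbF.
pose B := [fset (e * h i)%g | e in E, i in iota 0 n]%fset.
have [x xB] : exists x, x \notin B.
  apply: contrapT => /forallNP allB; apply: infG.
  apply: sub_finite_set (finite_fset B) => x _.
  by apply/negPn/negP; exact: allB.
exists (fun k => if k == n then x else h k) => i j /andP[ij].
rewrite ltnS leq_eqVlt => /predU1P[jn|jn]; last first.
  by rewrite !ltn_eqF ?(ltn_trans ij jn) // hP // ij.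
rewrite jn eqxx ltn_eqF; last by rewrite -jn.
apply: contra xB => xE; apply/imfset2P; exists (x / h i)%g => //.
by exists i; [rewrite /= mem_iota -jn|rewrite mulgVK].
Qed.

(* If the translates [k^-1 h_i W0] of a marker set [W0] are disjoint, then so are
   the sets [V `&` \bigcup_k k^-1 h_i W0]; each of them is a marker set because
   every [h_i w] lies in some [k V]. *)
Lemma marker_split (I : finType) (V : set X) :
  infinite_set [set: G] -> marker_property act -> marker_set act V ->
  exists W : I -> set X, [/\ forall i, marker_set act (W i),
    forall i, W i `<=` V & trivIset [set: I] W].
Proof.
move=> infG mp mV; have [D DX] := marker_finite_cover mV; have [oV _] := mV.
have [h hP] :=
  infinite_avoid_translates [fset (k / l)%g | k in D, l in D]%fset #|I| infG.
have [W0 [[oW0 W0X] freeW0]] :=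
  mp [fset (k^-1 * h i)%g | k in D, i in iota 0 #|I|]%fset.
pose r (i : I) : nat := enum_rank i.
pose W i := V `&` \bigcup_(k in [set` D]) tr (k^-1 * h (r i))%g W0.
have r_inj : injective r by move=> i j /ord_inj/enum_rank_inj.
exists W; split => [i|i x []//|].
  split.
    apply: openI => //; apply: bigcup_open => k _; exact: translate_open.
  apply/seteqP; split => // x _.
  have : (\bigcup_(g in [set: G]) tr g W0) x by rewrite W0X.
  move=> [g _ [w W0w gw]].
  have [//|k Dk [v Vv kv]] := DX (act (h (r i)) w).
  have vE : act (k^-1 * h (r i))%g w = v by rewrite actM -kv actK.
  exists (g * (k^-1 * h (r i))^-1)%g => //; exists v; last first.
    by rewrite actM -vE actK.
  by split=> //; exists k => //; exists w.
move=> i j _ _ [x [[_ [k Dk kx]] [_ [l Dl lx]]]].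
have inL o q : q \in D ->
    (q^-1 * h (r o))%g \in [fset (k^-1 * h i)%g | k in D, i in iota 0 #|I|]%fset.
  move=> Dq; apply/imfset2P; exists q => //; exists (r o) => //.
  by rewrite /= mem_iota /= add0n ltn_ord.
(* Translates of [W0] that meet have equal group elements, so [k^-1 h_i = l^-1 h_j]. Then
   [h_j / h_i = l / k], which the choice of [h] excludes for distinct ranks. *)
have /= kl := freeW0 _ _ (inL i k Dk) (inL j l Dl) (ex_intro _ x (conj kx lx)).
have klE : (h (r j) / h (r i))%g = (l / k)%g.
  by rewrite -[h (r j)](mulVKg l) -kl !mulgA mulgK.
have rlt o : (r o < #|I|)%N by exact: ltn_ord.
apply: r_inj; case: (ltngtP (r i) (r j)) => // ij.
- have := hP (r i) (r j); rewrite ij rlt klE => /(_ isT)/imfset2P[].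
  by exists l => //; exists k.
- have := hP (r j) (r i); rewrite ij rlt -invgF klE invgF => /(_ isT)/imfset2P[].
  by exists k => //; exists l.
Qed.

(** Pieces coming from different indices cannot collide, as they are moved into disjoint targets
    [W i]. *)
Lemma subequivalent_sum (I : finType) (A W : I -> set X) (V : set X) :
  (forall i, W i `<=` V) -> trivIset [set: I] W ->
  (forall i, subequivalent act (fun _ : unit => A i) (W i)) ->
  subequivalent act A V.
Proof.
move=> WV disjW subA.
have /choice[p pP] : forall i, exists p : nat * (nat -> set X) * (nat -> G),
    [/\ forall k, (k < p.1.1)%N -> open (p.1.2 k),
        A i `<=` \bigcup_(k in [set k | (k < p.1.1)%N]) p.1.2 k,
        forall k, (k < p.1.1)%N -> tr (p.2 k) (p.1.2 k) `<=` W i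
      & trivIset [set k | (k < p.1.1)%N] (fun k => tr (p.2 k) (p.1.2 k))].
  move=> i; have [n [U [g [oU AU UW disjU]]]] := subA i.
  exists (n tt, U tt, g tt); split => //= [k|k|k l kn ln kl].
  - exact: oU.
  - exact: UW.
  - by have [] := disjU (tt, k) (tt, l) kn ln kl.
exists (fun i => (p i).1.1), (fun i => (p i).1.2), (fun i => (p i).2); split.
- by move=> i; have [] := pP i.
- by move=> i; have [] := pP i.
- by move=> i k kn; have [_ _ + _] := pP i; move=> /(_ k kn)/subset_trans; exact.
move=> [i k] [j l] /= kn ln [x [kx lx]].
have [_ _ iW disji] := pP i; have [_ _ jW _] := pP j.
have ij : i = j by apply: disjW => //; exists x; split; [exact: iW kx|exact: jW lx].
by subst j; congr (_, _); apply: disji => //; exists x.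
Qed.

Lemma URPC_FCSB (R : realType) :
  free_action act -> infinite_set [set: G] -> URPC act R -> FCSB act.
Proof.
move=> act_free infG [urp cmp].
have mp : marker_property act by exact: URP_marker_property urp.
split=> // F V mV; have [m mP] := URP_uniform_FCSB_in_measure act_free F urp.
(* One target for each of the [m] boundaries, and [None] for the uncovered set. As [m] is
   independent of the tolerance, the targets can be fixed before [e0]. *)
have [W [mW WV disjW]] := marker_split (option 'I_m) infG mp mV.
have /choice[e eP] : forall o, exists e : R, (0 < e)%R /\
    forall mu : invariant_measure act R, (e%:E <= mu (W o))%E.
  by move=> o; have [e e0 eW] := marker_measure_gt0 R (mW o); exists e.
pose e0 : R := \big[Num.min/1%R]_o e o.
have e0_gt0 : (0 < e0)%R by apply: lt_bigmin => // o _; have [] := eP o.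
have [U [oU muU]] := mP e0 e0_gt0.
exists m, U; split => //; apply: (subequivalent_sum WV disjW) => o; apply: cmp.
- case: o => [i|]; first exact: closed_boundary.
  by apply: open_closedC; apply: bigcup_open => i _; have [] := oU i.
- by have [] := mW o.
move=> mu; have [_ /(_ mu)] := eP o; apply: lt_le_trans.
apply: (@lt_le_trans _ _ e0%:E); last by rewrite lee_fin bigmin_le_cond.
(* Each closed set is a single term of the sum of nonnegative measures bounded by [e0]. *)
apply: le_lt_trans (muU mu); case: o => [i|].
  rewrite (bigD1 i) //= -addeA leeDl //.
  by rewrite adde_ge0 ?sume_ge0 ?im_ge0 // => *; exact: im_ge0.
by rewrite leeDr // sume_ge0 // => *; exact: im_ge0.
Qed.

End FCSB.
End actions.

Theorem proposition4p5 (R : realType) (G : groupType) (X : topologicalType)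
    (act : G -> X -> X)
    (G_countable : countable [set: G]) (G_infinite : infinite_set [set: G])
    (G_amenable : amenable R G)
    (X_compact : compact [set: X]) (X_metrizable : metrizable R X)
    (act_homeo : action_by_homeo act) (act_free : free_action act) :
  (URPC act R -> FCSB act) /\ (URP act R -> FCSB_in_measure act R).
Proof.
split; first exact: URPC_FCSB.
exact: URP_FCSB_in_measure.
Qed.
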